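(* Assume $\tau\ge\frac52$. On the Bakhvalov-type mesh $\{x_i\}_{i=0}^N$ with parameter $\tau$ described in the context, with mesh sizes $h_i=x_{i+1}-x_i$, there is a constant $C>0$, independent of $\varepsilon_1,\varepsilon_2$ and $N$, such that $$\max_{i=0,1,\dots,\frac N4-3}\left\{(h_{i+1}-h_i)e^{-p\mu_0x_{i+1}}\right\}\le C\mu_0^{-1}N^{-2}.$$
   Context: Let $0<\varepsilon_1,\varepsilon_2\ll1$ be small parameters and let $b,c$ be sufficiently smooth functions on $[0,1]$ with $b\ge\lambda>0$, $c\ge\beta>0$, $c-\frac12\varepsilon_2b'\ge\gamma>0$ on $[0,1]$ for constants $\lambda,\beta,\gamma$ (the coefficients of $-\varepsilon_1u''+\varepsilon_2bu'+cu=f$ in $(0,1)$, $u(0)=u(1)=0$). For $x\in[0,1]$ let $g_0(x)<0<g_1(x)$ be the two real roots $g$ of $-\varepsilon_1g^2+\varepsilon_2b(x)g+c(x)=0$, and set $\mu_0=-\max_{0\le x\le1}g_0(x)$, $\mu_1=\min_{0\le x\le1}g_1(x)$; one has $1\ll\mu_0\le\mu_1$. Fix $p\in(0,1)$. Mesh. Let $N\ge16$ be an integer divisible by $4$, $\tau\geq 1$ a parameter, and $\sigma_j=\frac{\tau}{p\mu_j}\ln\mu_j$ for $j=0,1$, where it is assumed that $\sigma_j\le\frac14$. It is also assumed throughout that $\mu_1^{-1}\le\mu_0^{-1}\le N^{-1}$. With $t_i=i/N$, $\varphi_0(t)=-\ln(1-4(1-\mu_0^{-1})t)$ and $\varphi_1(t)=-\ln(1-4(1-\mu_1^{-1})(1-t))$,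 the Bakhvalov-type mesh is $$x_i=\begin{cases}\frac{\tau}{p\mu_0}\varphi_0(t_i), & i=0,\dots,\frac N4,\\ \sigma_0+2(t_i-\frac14)(1-\sigma_0-\sigma_1), & i=\frac N4,\dots,\frac{3N}4,\\ 1-\frac{\tau}{p\mu_1}\varphi_1(t_i), & i=\frac{3N}4,\dots,N.\end{cases}$$ *)

(* Defs.v *)
From HB Require Import structures.
From mathcomp Require Import all_boot all_order all_algebra.
From mathcomp Require Import all_classical all_reals all_analysis.
Set Implicit Arguments.
Unset Strict Implicit.
Unset Printing Implicit Defensive.
Import Order.TTheory GRing.Theory Num.Theory.
Import numFieldNormedType.Exports.
Local Open Scope classical_set_scope.
Local Open Scope ring_scope.

Section Definitions.
Context {R : realType}.
Implicit Types (A : set R) (f df b c : R -> R) (N i : nat).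
Implicit Types (m x t p tau mu : R).

(* Derivative relative to A: on A = `[0, 1] it is one-sided at the endpoints,
   so the values of f outside A are irrelevant. *)
Definition C1_on A f df : Prop :=
  (forall x, A x ->
     (f y - f x) / (y - x) @[y --> within A x^'] --> df x) /\
  {within A, continuous df}.

Definition is_maximum A m : Prop := A m /\ ubound A m.
Definition is_minimum A m : Prop := A m /\ lbound A m.

Definition char_poly (eps1 eps2 : R) b c x (g : R) : R :=
  - eps1 * g ^+ 2 + eps2 * b x * g + c x.

(* A quadratic has at most two roots, so the sign condition determines
   g0 x and g1 x uniquely. *)
Definition char_roots (eps1 eps2 : R) b c (g0 g1 : R -> R) : Prop :=
  forall x, 0 <= x <= 1 ->
    [/\ char_poly eps1 eps2 b c x (g0 x) = 0,
        char_poly eps1 eps2 b c x (g1 x) = 0,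
        g0 x < 0 & 0 < g1 x].

Definition sigma tau p mu : R := tau / (p * mu) * ln mu.

Definition phi0 mu t : R := - ln (1 - 4 * (1 - mu^-1) * t).
Definition phi1 mu t : R := - ln (1 - 4 * (1 - mu^-1) * (1 - t)).

Definition grid N i : R := i%:R / N%:R.

(* Meaningful for 4 %| N and i <= N. At i = N / 4 and i = 3 N / 4 the adjacent
   formulas agree, because phi0 mu0 (1/4) = ln mu0 and phi1 mu1 (3/4) = ln mu1. *)
Definition mesh tau p (mu0 mu1 : R) N i : R :=
  if (i <= N %/ 4)%N then tau / (p * mu0) * phi0 mu0 (grid N i)
  else if (i <= 3 * N %/ 4)%N then
    sigma tau p mu0
    + 2 * (grid N i - 4^-1) * (1 - sigma tau p mu0 - sigma tau p mu1)
  else 1 - tau / (p * mu1) * phi1 mu1 (grid N i).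

Definition mesh_size tau p (mu0 mu1 : R) N i : R :=
  mesh tau p mu0 mu1 N i.+1 - mesh tau p mu0 mu1 N i.

(* The maximum of F 0, ..., F n; the initial value F 0 of the iteration is one
   of the terms, so it does not affect the result. *)
Definition max_upto (n : nat) (F : nat -> R) : R :=
  \big[Num.max/F 0%N]_(0 <= i < n.+1) F i.

End Definitions.

(* Main.v *)
(* In the layer x_i = - tau / (p mu0) ln y_i with y_i = 1 - i d and
   d = 4 (1 - 1 / mu0) / N, so the weight is y_(i+1) ^ tau and the second
   difference of the mesh is tau / (p mu0) ln (y^2 / (y^2 - d^2)), where
   y = y_(i+1). The restriction i <= N / 4 - 3 gives y >= 2 d, whence
   ln (y^2 / (y^2 - d^2)) <= d^2 / (y^2 - d^2) <= (4 / 3) d^2 / y^2, and the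
   weight absorbs y^-2 because tau >= 2. *)
Require Import Defs.
From HB Require Import structures.
From mathcomp Require Import all_boot all_order all_algebra.
From mathcomp Require Import all_classical all_reals all_analysis.
From mathcomp Require Import ring lra zify.
Import Order.TTheory GRing.Theory Num.Theory.
Import numFieldNormedType.Exports.
Local Open Scope classical_set_scope.
Local Open Scope ring_scope.

Lemma ln_second_difference_le (R : realType) (y d : R) :
  0 < d -> 2 * d <= y ->
  - ln (y - d) - ln (y + d) + 2 * ln y <= 4 / 3 * (d / y) ^+ 2.
Proof.
move=> d0 dy.
have y0 : 0 < y by lra.
have ym : 0 < y - d by lra.
have yp : 0 < y + d by lra.
have den : 0 < (y - d) * (y + d) by rewrite mulr_gt0.
have -> : - ln (y - d) - ln (y + d) + 2 * ln y
    = ln (y ^+ 2 / ((y - d) * (y + d))).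
  rewrite ln_div ?posrE ?exprn_gt0// lnM ?posrE// lnXn// mulr2n; ring.
apply: le_trans (_ : _ <= y ^+ 2 / ((y - d) * (y + d)) - 1) _.
  have q0 : 0 < y ^+ 2 / ((y - d) * (y + d)) by rewrite divr_gt0 ?exprn_gt0.
  (* This is ln q <= q - 1, obtained from 1 + z <= exp z at z = ln q. *)
  have := expR_ge1Dx (ln (y ^+ 2 / ((y - d) * (y + d)))).
  by rewrite lnK ?posrE//; lra.
have -> : y ^+ 2 / ((y - d) * (y + d)) - 1 = d ^+ 2 / ((y - d) * (y + d)).
  by field; rewrite !gt_eqF.
(* With denominators cleared and d^2 factored out, the claim is y^2 <= 4/3 (y^2 - d^2), that is, 4
   d^2 <= y^2. *)
rewrite expr_div_n mulrA ler_pdivrMr// mulrAC ler_pdivlMr ?exprn_gt0//.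
have d2y2 : (2 * d) ^+ 2 <= y ^+ 2 by rewrite ler_sqr ?nnegrE; lra.
have -> : 4 / 3 * d ^+ 2 * ((y - d) * (y + d))
    = d ^+ 2 * (4 / 3 * (y ^+ 2 - d ^+ 2)) by ring.
rewrite ler_wpM2l ?sqr_ge0//; move: d2y2; rewrite exprMn; lra.
Qed.

Lemma weighted_ln_second_difference_le (R : realType) (tau y d : R) :
  2 <= tau -> 0 < d -> 2 * d <= y -> y <= 1 ->
  (- ln (y - d) - ln (y + d) + 2 * ln y) * expR (tau * ln y)
  <= 4 / 3 * d ^+ 2.
Proof.
move=> tau2 d0 dy y1.
have y0 : 0 < y by lra.
(* Since y <= 1 makes ln y nonpositive, raising the exponent from 2 to [tau] can only decrease the
   power of y. *)
have weight : expR (tau * ln y) <= y ^+ 2.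
  rewrite -{2}(lnK (x := y)) ?posrE// -expRM_natl ler_expR.
  by apply: ler_wnM2r => //; exact: ln_le0.
apply: le_trans.
  apply: ler_wpM2r; first exact: expR_ge0.
  exact: ln_second_difference_le.
apply: le_trans (_ : _ <= 4 / 3 * (d / y) ^+ 2 * y ^+ 2) _.
  by rewrite ler_wpM2l// mulr_ge0 ?sqr_ge0//; lra.
by rewrite -mulrA -exprMn divfK ?gt_eqF.
Qed.

(** Writing the argument of [ln] as one minus a multiple of a fixed step makes the arguments at
    neighbouring nodes differ by exactly that step. *)
Lemma mesh_layerE (R : realType) (tau p mu0 mu1 : R) (N i : nat) :
  (i <= N %/ 4)%N ->
  mesh tau p mu0 mu1 N i
  = - (tau / (p * mu0)) * ln (1 - i%:R * (4 * (1 - mu0^-1) / N%:R)).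
Proof.
move=> iN; rewrite /mesh iN /phi0 /grid mulrN mulNr.
by congr (- (_ * ln _)); ring.
Qed.

Lemma layer_weighted_second_difference_le
    (R : realType) (tau p mu0 mu1 : R) (N i : nat) :
  2 <= tau -> 0 < p -> 1 < mu0 -> (i.+3 <= N %/ 4)%N ->
  (mesh_size tau p mu0 mu1 N i.+1 - mesh_size tau p mu0 mu1 N i)
    * expR (- p * mu0 * mesh tau p mu0 mu1 N i.+1)
  <= 64 * tau / (3 * p) * mu0^-1 * N%:R^-1 ^+ 2.
Proof.
move=> tau2 p0 mu0_gt1 iN.
have mu0_gt0 : 0 < mu0 by lra.
have mui0 : 0 < mu0^-1 by rewrite invr_gt0.
have mui1 : mu0^-1 < 1 by rewrite invf_lt1.
have N0 : 0 < N%:R :> R by rewrite ltr0n; lia.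
rewrite /mesh_size !mesh_layerE; [|lia..].
set d := 4 * (1 - mu0^-1) / N%:R.
have d0 : 0 < d by rewrite divr_gt0// mulr_gt0//; lra.
have dN : d * N%:R = 4 * (1 - mu0^-1) by rewrite divfK ?gt_eqF.
(* The last node involved is [i.+2]; the spare index gives (i + 3) d <= N d / 4 = 1 - 1 / mu0 < 1,
   hence [2 * d <= y] below. *)
have i3N : 4 * (i%:R + 3) <= N%:R :> R.
  by rewrite -natrD -natrM ler_nat; lia.
set y := 1 - i.+1%:R * d.
have yE : y = 1 - (i%:R + 1) * d by rewrite /y -natr1.
have -> : 1 - i.+2%:R * d = y - d by rewrite yE -!natr1; ring.
have -> : 1 - i%:R * d = y + d by rewrite yE; ring.
have i0 : 0 <= i%:R :> R by exact: ler0n.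
have dy : 2 * d <= y by rewrite yE; nra.
have y1 : y <= 1 by rewrite yE; nra.
have -> : - p * mu0 * (- (tau / (p * mu0)) * ln y) = tau * ln y.
  by field; rewrite !gt_eqF.
set k := tau / (p * mu0).
have k0 : 0 < k by rewrite divr_gt0 ?mulr_gt0//; lra.
have -> : - k * ln (y - d) - - k * ln y - (- k * ln y - - k * ln (y + d))
   = k * (- ln (y - d) - ln (y + d) + 2 * ln y) by ring.
rewrite -mulrA.
have := weighted_ln_second_difference_le R tau y d tau2 d0 dy y1.
rewrite -(ler_pM2l k0) => /le_trans; apply.
(* The constant splits as 64 / 3 = (4 / 3) * 4^2, where 4 / N bounds d. *)
have -> : 64 * tau / (3 * p) * mu0^-1 * N%:R^-1 ^+ 2
   = k * (4 / 3 * (4 / N%:R) ^+ 2) by rewrite /k; field; rewrite !gt_eqF.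
rewrite ler_pM2l// ler_pM2l; last lra.
have dle : d <= 4 / N%:R by rewrite ler_pM2r ?invr_gt0//; lra.
by rewrite ler_sqr ?nnegrE// ltW// (lt_le_trans d0).
Qed.

Lemma max_upto_le (R : realType) (n : nat) (F : nat -> R) (m : R) :
  (forall i, (i <= n)%N -> F i <= m) -> max_upto n F <= m.
Proof.
move=> Fm; rewrite /max_upto big_seq.
by apply: bigmax_le => [|i]; [|rewrite mem_index_iota ltnS]; exact: Fm.
Qed.

Theorem lemma4 (R : realType) (b b' c c' : R -> R)
    (lambda beta gamma p tau : R)
    (b_smooth : C1_on `[0, 1] b b') (c_smooth : C1_on `[0, 1] c c')
    (lambda_gt0 : 0 < lambda) (beta_gt0 : 0 < beta) (gamma_gt0 : 0 < gamma)
    (b_ge : forall x, 0 <= x <= 1 -> lambda <= b x)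
    (c_ge : forall x, 0 <= x <= 1 -> beta <= c x)
    (p_gt0 : 0 < p) (p_lt1 : p < 1)
    (tau_ge : 5 / 2 <= tau) :
  exists2 C : R, 0 < C &
    forall (eps1 eps2 mu0 mu1 : R) (g0 g1 : R -> R) (N : nat),
      0 < eps1 < 1 -> 0 < eps2 < 1 ->
      (forall x, 0 <= x <= 1 -> gamma <= c x - 2^-1 * eps2 * b' x) ->
      char_roots eps1 eps2 b c g0 g1 ->
      is_maximum (g0 @` `[0, 1]) (- mu0) ->
      is_minimum (g1 @` `[0, 1]) mu1 ->
      (16 <= N)%N -> (4 %| N)%N ->
      sigma tau p mu0 <= 4^-1 -> sigma tau p mu1 <= 4^-1 ->
      mu1^-1 <= mu0^-1 -> mu0^-1 <= N%:R^-1 ->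
      max_upto (N %/ 4 - 3) (fun i =>
        (mesh_size tau p mu0 mu1 N i.+1 - mesh_size tau p mu0 mu1 N i)
        * expR (- p * mu0 * mesh tau p mu0 mu1 N i.+1))
      <= C * mu0^-1 * N%:R^-1 ^+ 2.
Proof.
exists (64 * tau / (3 * p)); first by rewrite divr_gt0//; lra.
move=> eps1 eps2 mu0 mu1 g0 g1 N _ _ _ roots [[x x01 g0x] _] _ N16 _ _ _ _ muN.
(* The maximum is attained: [- mu0] is the value of [g0] at [x], hence negative. *)
have mu0_gt0 : 0 < mu0.
  have [|_ _ + _] := roots x; first by move: x01; rewrite /= in_itv.
  by rewrite g0x oppr_lt0.
have mu0_gt1 : 1 < mu0.
  rewrite -invf_lt1//; apply: le_lt_trans muN _.
  by rewrite invf_lt1 ?ltr0n ?ltr1n; lia.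
apply: max_upto_le => i iN.
(* As [N] is at least 16, the truncated subtraction in [N %/ 4 - 3] is a true one, so
   [i <= N %/ 4 - 3] yields [i.+3 <= N %/ 4]. *)
apply: layer_weighted_second_difference_le => //; [lra|lia].
Qed.
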